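(* $$\int_0^{1} e^{-\arcsin^2(x)}\,dx = \frac{\sqrt{\pi}\, e^{-1/4}}{4}\left[\mathrm{erfc}\!\left(\frac{i}{2}\right)+\mathrm{erfc}\!\left(-\frac{i}{2}\right)+i\left(\mathrm{erfi}\!\left(\frac{1}{2}-\frac{i\pi}{2}\right)-\mathrm{erfi}\!\left(\frac{1}{2}+\frac{i\pi}{2}\right)+2i\right)\right].$$
   Context: For complex $z$, the following entire functions are used: $\mathrm{erf}(z)=\frac{2}{\sqrt{\pi}}\int_0^z e^{-t^2}\,dt$; the complementary error function $\mathrm{erfc}(z)=\frac{2}{\sqrt{\pi}}\int_z^{\infty} e^{-t^2}\,dt=1-\mathrm{erf}(z)$; and the imaginary error function $\mathrm{erfi}(z)=\frac{2}{\sqrt{\pi}}\int_0^z e^{t^2}\,dt$. Integrals from $0$ to $z$ may be taken along the straight segment. Here $i$ is the imaginary unit. *)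

(* Defs.v *)
From Stdlib Require Import Reals.
From Coquelicot Require Import Coquelicot.

Open Scope R_scope.

(* Coquelicot has no complex exponential; this is exp (x + iy) = e^x (cos y + i sin y). *)
Definition Cexp (z : C) : C :=
  (exp (Re z) * cos (Im z), exp (Re z) * sin (Im z)).

(* Integral of [f] along the straight segment t |-> a + t (b - a), t in [0, 1]. *)
Definition Csegment_int (f : C -> C) (a b : C) : C :=
  ((b - a) * RInt (V := C_R_CompleteNormedModule)
               (fun t : R => f (a + t * (b - a))%C) 0 1)%C.

(* Integral of [f] from [a] to infinity along the horizontal ray s |-> a + s, s >= 0.
   For the entire function exp (- t^2) any other path from [a] tending to infinity
   along the positive real direction gives the same value. *)
Definition Cray_int (f : C -> C) (a : C) : C :=
  RInt_gen (V := C_R_CompleteNormedModule)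
    (fun s : R => f (a + s)%C) (at_point 0) (Rbar_locally p_infty).

Definition erf (z : C) : C :=
  (2 / sqrt PI * Csegment_int (fun t => Cexp (- t ^ 2)) 0 z)%C.

Definition erfc (z : C) : C :=
  (2 / sqrt PI * Cray_int (fun t => Cexp (- t ^ 2)) z)%C.

Definition erfi (z : C) : C :=
  (2 / sqrt PI * Csegment_int (fun t => Cexp (t ^ 2)) 0 z)%C.

(* Main.v *)
(* With x = sin t the left-hand side is I, the integral of exp (- t^2) cos t over [0, PI/2].
   Moving the segment from 0 to 1/2 + i PI/2 onto the path 0 -> 1/2 -> 1/2 + i PI/2 gives
   2 exp (1/4) I / sqrt PI as the imaginary part of erfi (1/2 + i PI/2); moving the ray
   i y + [0, oo) onto the path i y -> 0 -> oo shows that erfc (i y) has real part 1 and an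
   imaginary part odd in y, so the two erfc terms cancel 2 i^2. Each contour shift, and also
   the Gaussian integral, comes from one fact: if d/du h(u, t) = d/dt g(u, t), the u-derivative
   of the integral of h(u, .) over [a, b] is g(u, b) - g(u, a). *)
Require Import Defs.
From Stdlib Require Import Reals Lra.
From Coquelicot Require Import Coquelicot.

Open Scope R_scope.

(** * Parameter integrals whose differentiated integrand is exact *)

(** Differentiation under the integral sign, then the fundamental theorem of calculus. Joint
    continuity of [k] serves both: the first directly, the second with its first argument frozen at
    [y]. *)
Lemma is_derive_RInt_exact (h k g : R -> R -> R) (a b y : R) :
  (forall u t, is_derive (fun v => h v t) u (k u t)) ->
  (forall u t, is_derive (g u) t (k u t)) ->
  (forall u t, continuous (h u) t) ->
  (forall u t, continuity_2d_pt k u t) ->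
  is_derive (fun u => RInt (h u) a b) y (g y b - g y a).
Proof.
intros Hh Hg Ch Ck.
assert (E : RInt (fun t => Derive (fun u => h u t) y) a b = g y b - g y a).
{ rewrite (RInt_ext _ (k y)) by (intros; apply is_derive_unique, Hh).
  apply is_RInt_unique, (is_RInt_derive (g y) (k y)).
  - intros; apply Hg.
  - intros t _; apply continuity_pt_filterlim.
    intros e He; destruct (Ck y t (mkposreal e He)) as [d Hd].
    exists d; split; [apply cond_pos|].
    intros x [_ Hx]; apply Hd; [|exact Hx].
    rewrite Rminus_diag, Rabs_R0; apply cond_pos. }
rewrite <- E.
apply is_derive_RInt_param.
- apply filter_forall; intros u t _; exists (k u t); apply Hh.
- intros t _; apply continuity_2d_pt_ext with k; [|apply Ck].
  intros u v; symmetry; apply is_derive_unique, Hh.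
- apply filter_forall; intros u.
  apply (ex_RInt_continuous (V := R_CompleteNormedModule)); intros; apply Ch.
Qed.

Ltac continuity_2d :=
  intros; unfold pow;
  repeat first
    [ apply continuity_2d_pt_const
    | apply continuity_2d_pt_id1
    | apply continuity_2d_pt_id2
    | apply continuity_2d_pt_plus
    | apply continuity_2d_pt_minus
    | apply continuity_2d_pt_opp
    | apply continuity_2d_pt_mult
    | apply (continuity_1d_2d_pt_comp exp); [apply derivable_continuous, derivable_exp|]
    | apply (continuity_1d_2d_pt_comp cos); [apply continuity_cos|]
    | apply (continuity_1d_2d_pt_comp sin); [apply continuity_sin|] ].

Ltac continuous_by_derive :=
  intros; apply (ex_derive_continuous (V := R_NormedModule)); auto_derive; trivial.

Ltac ex_RInt_by_derive :=
  apply (ex_RInt_continuous (V := R_CompleteNormedModule)); continuous_by_derive.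

(** * The Gaussian integral *)

Lemma is_lim_exp_opp_sqr : is_lim (fun x => exp (- x ^ 2)) p_infty 0.
Proof.
apply (is_lim_comp exp (fun x => - x ^ 2) p_infty 0 m_infty).
- apply is_lim_exp_m.
- replace m_infty with (Rbar_opp p_infty) by reflexivity.
  apply is_lim_opp.
  apply (is_lim_le_p_loc (fun x => x)); [|apply is_lim_id].
  exists 1; intros x Hx; nra.
- exists 0; intros; discriminate.
Qed.

Definition gauss (x : R) : R := RInt (fun t => exp (- t ^ 2)) 0 x.

Lemma is_derive_gauss (x : R) : is_derive gauss x (exp (- x ^ 2)).
Proof.
apply (is_derive_RInt (V := R_NormedModule) (fun t => exp (- t ^ 2)) gauss 0).
- apply filter_forall; intros y; apply (RInt_correct (V := R_CompleteNormedModule)).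
  ex_RInt_by_derive.
- continuous_by_derive.
Qed.

(** The derivatives of [gauss y ^ 2] and of the integral [B y] cancel, so their sum keeps its value
    at 0, where the integrand of [B] is the derivative of [atan]. *)
Lemma gauss_sqr (x : R) : 0 < x ->
  gauss x ^ 2 = PI / 4 - RInt (fun t => exp (- (x ^ 2 * (1 + t ^ 2))) / (1 + t ^ 2)) 0 1.
Proof.
intros Hx.
set (B := fun y => RInt (fun t => exp (- (y ^ 2 * (1 + t ^ 2))) / (1 + t ^ 2)) 0 1).
assert (HB : forall y, is_derive B y (- 2 * exp (- y ^ 2) * gauss y)).
{ intros y.
  (* Since exp (- y^2 (1 + t^2)) = exp (- y^2) exp (- (y t)^2), a t-antiderivative of the
     differentiated integrand is [- 2 * exp (- y ^ 2) * gauss (y * t)], which vanishes at t = 0. *)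
  replace (- 2 * exp (- y ^ 2) * gauss y)
    with (- 2 * exp (- y ^ 2) * gauss (y * 1) - - 2 * exp (- y ^ 2) * gauss (y * 0)).
  2:{ rewrite Rmult_1_r, Rmult_0_r; unfold gauss at 2; rewrite RInt_point.
      unfold zero; simpl; ring. }
  apply (is_derive_RInt_exact
    (fun y t => exp (- (y ^ 2 * (1 + t ^ 2))) / (1 + t ^ 2))
    (fun y t => - 2 * y * exp (- (y ^ 2 * (1 + t ^ 2))))
    (fun y t => - 2 * exp (- y ^ 2) * gauss (y * t))).
  - intros u t; auto_derive.
    + nra.
    + simpl; field; nra.
  - intros u t.
    replace (- 2 * u * exp (- (u ^ 2 * (1 + t ^ 2))))
      with (- 2 * exp (- u ^ 2) * (u * exp (- (u * t) ^ 2))).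
    2:{ replace (- (u ^ 2 * (1 + t ^ 2))) with (- u ^ 2 + - (u * t) ^ 2) by ring.
        rewrite exp_plus; ring. }
    apply (is_derive_scal (fun s => gauss (u * s))).
    apply (is_derive_comp gauss (fun s => u * s)).
    + apply is_derive_gauss.
    + auto_derive; [trivial | ring].
  - continuous_by_derive; nra.
  - continuity_2d. }
assert (B0 : B 0 = PI / 4).
{ unfold B; rewrite (RInt_ext _ (fun t => / (1 + t ^ 2))).
  - replace (PI / 4) with (minus (atan 1) (atan 0)).
    2:{ rewrite atan_0, atan_1; unfold minus, plus, opp; simpl; ring. }
    apply is_RInt_unique, (is_RInt_derive atan).
    + intros; auto_derive; [trivial|]; unfold Rsqr; simpl; field; nra.
    + continuous_by_derive; nra.
  - intros t _; rewrite pow_i by auto with arith.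
    rewrite Rmult_0_l, Ropp_0, exp_0; apply Rmult_1_l. }
assert (H : gauss 0 ^ 2 + B 0 = gauss x ^ 2 + B x).
{ apply (eq_is_derive (fun y => gauss y ^ 2 + B y)); [|exact Hx].
  intros y _.
  change (is_derive (fun y => gauss y ^ 2 + B y) y 0).
  replace 0 with (2 * exp (- y ^ 2) * gauss y + - 2 * exp (- y ^ 2) * gauss y) by ring.
  apply (is_derive_plus (fun y => gauss y ^ 2) B); [|apply HB].
  replace (2 * exp (- y ^ 2) * gauss y) with (INR 2 * exp (- y ^ 2) * gauss y ^ 1)
    by (simpl; ring).
  apply is_derive_pow, is_derive_gauss. }
fold (B x); rewrite <- B0.
unfold gauss at 1 in H; rewrite RInt_point in H; unfold zero in H; simpl in H; simpl; lra.
Qed.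

(** The integral subtracted in [gauss_sqr] lies between 0 and exp (- x^2), so the square tends to
    PI/4. As [gauss] is nonnegative for x > 0, continuity of [sqrt] finishes. *)
Lemma is_lim_gauss : is_lim gauss p_infty (sqrt PI / 2).
Proof.
assert (L : is_lim (fun x => gauss x ^ 2) p_infty (PI / 4)).
{ apply (is_lim_le_le_loc (fun x => PI / 4 - exp (- x ^ 2)) (fun _ => PI / 4)).
  - exists 0; intros x Hx; rewrite gauss_sqr by exact Hx.
    assert (ex_RInt (fun t => exp (- (x ^ 2 * (1 + t ^ 2))) / (1 + t ^ 2)) 0 1)
      by (ex_RInt_by_derive; nra).
    split.
    + apply Rplus_le_compat_l, Ropp_le_contravar.
      replace (exp (- x ^ 2)) with (RInt (fun _ => exp (- x ^ 2)) 0 1).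
      2:{ rewrite RInt_const; unfold scal; simpl; unfold mult; simpl; ring. }
      apply RInt_le; [lra | assumption | apply ex_RInt_const |].
      intros t Ht; apply Rle_trans with (exp (- x ^ 2) / 1).
      * apply Rmult_le_compat.
        -- apply Rlt_le, exp_pos.
        -- apply Rlt_le, Rinv_0_lt_compat; nra.
        -- destruct (Rle_lt_or_eq_dec 0 (x ^ 2 * t ^ 2)) as [l|e].
           { apply Rmult_le_pos; apply pow2_ge_0. }
           { apply Rlt_le, exp_increasing; nra. }
           { apply Req_le; f_equal; nra. }
        -- apply Rinv_le_contravar; nra.
      * lra.
    + assert (0 <= RInt (fun t => exp (- (x ^ 2 * (1 + t ^ 2))) / (1 + t ^ 2)) 0 1);
        [|lra].
      apply RInt_ge_0; [lra | assumption |].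
      intros t _; apply Rlt_le, Rdiv_lt_0_compat; [apply exp_pos | nra].
  - replace (Finite (PI / 4)) with (Rbar_minus (PI / 4) 0) by (simpl; f_equal; ring).
    apply is_lim_minus'; [apply is_lim_const | apply is_lim_exp_opp_sqr].
  - apply is_lim_const. }
replace (sqrt PI / 2) with (sqrt (PI / 4)).
2:{ rewrite sqrt_div by (generalize PI_RGT_0; lra).
    replace 4 with (2 * 2) by ring; rewrite sqrt_square by lra; reflexivity. }
apply (is_lim_ext_loc (fun x => sqrt (gauss x ^ 2))).
- exists 0; intros x Hx; apply sqrt_pow2, RInt_ge_0.
  + lra.
  + ex_RInt_by_derive.
  + intros; apply Rlt_le, exp_pos.
- apply (filterlim_comp _ _ _ _ sqrt _ _ _ L), continuity_pt_filterlim.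
  apply continuity_pt_sqrt; generalize PI_RGT_0; lra.
Qed.

(** * Contour shift for erfc on the imaginary axis *)

(** A squeeze, used with [l] = 1 for the real part of the ray integral and [l] = 0 for its imaginary
    part. *)
Lemma is_lim_gauss_approx (F : R -> R) (l M : R) :
  (forall x, Rabs (F x - l * gauss x) <= M * exp (- x ^ 2)) ->
  is_lim F p_infty (l * (sqrt PI / 2)).
Proof.
intros H.
assert (L0 : is_lim (fun x => M * exp (- x ^ 2)) p_infty 0).
{ replace (Finite 0) with (Rbar_mult M 0) by (simpl; f_equal; ring).
  apply is_lim_scal_l, is_lim_exp_opp_sqr. }
assert (Lg : is_lim (fun x => l * gauss x) p_infty (l * (sqrt PI / 2)))
  by apply (is_lim_scal_l gauss l p_infty (sqrt PI / 2)), is_lim_gauss.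
apply (is_lim_le_le_loc (fun x => l * gauss x - M * exp (- x ^ 2))
                        (fun x => l * gauss x + M * exp (- x ^ 2))).
- exists 0; intros x _; apply Rabs_le_between', H.
- rewrite <- (Rminus_0_r (l * (sqrt PI / 2))); apply is_lim_minus'; assumption.
- rewrite <- (Rplus_0_r (l * (sqrt PI / 2))); apply is_lim_plus'; assumption.
Qed.

(* [F] is the integral over the horizontal side [i u, i u + T] of a rectangle; its derivative is
   the contribution of the vertical side at abscissa [T]. *)
Lemma increment_bound (F f : R -> R) (T y : R) :
  (forall u, is_derive F u (f u)) ->
  (forall u, Rabs (f u) <= exp (u ^ 2 - T ^ 2)) ->
  Rabs (F y - F 0) <= Rabs y * exp (y ^ 2) * exp (- T ^ 2).
Proof.
intros HF Hf.
destruct (MVT_gen F 0 y f) as [c [Hc ->]].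
- intros; apply HF.
- intros x _; apply continuity_pt_filterlim.
  apply (ex_derive_continuous (V := R_NormedModule)); exists (f x); apply HF.
- rewrite Rminus_0_r, Rabs_mult, Rmult_comm, Rmult_assoc.
  apply Rmult_le_compat_l; [apply Rabs_pos|].
  apply Rle_trans with (1 := Hf c).
  rewrite <- exp_plus.
  assert (Hcy : c ^ 2 <= y ^ 2).
  { unfold Rmin, Rmax in Hc; destruct (Rle_dec 0 y); nra. }
  destruct (Rle_lt_or_eq_dec _ _ Hcy) as [l|e].
  + apply Rlt_le, exp_increasing; lra.
  + rewrite e; apply Rle_refl.
Qed.

Lemma Rabs_mult_le_1 (a b : R) : 0 <= a -> -1 <= b <= 1 -> Rabs (a * b) <= a.
Proof. intros Ha Hb; apply Rabs_le; split; nra. Qed.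

(** The integrand is the real part of exp (- (s + i y)^2). Lowering the height from y to 0 turns the
    integral into [gauss T]; only the side at abscissa T contributes, the side on the imaginary axis
    having a factor sin 0. *)
Lemma is_lim_gauss_cos (y : R) :
  is_lim (fun T => RInt (fun s => exp (y ^ 2 - s ^ 2) * cos (2 * y * s)) 0 T)
    p_infty (sqrt PI / 2).
Proof.
rewrite <- (Rmult_1_l (sqrt PI / 2)).
apply is_lim_gauss_approx with (Rabs y * exp (y ^ 2)); intros T.
set (F := fun u => RInt (fun s => exp (u ^ 2 - s ^ 2) * cos (2 * u * s)) 0 T).
replace (1 * gauss T) with (F 0).
2:{ rewrite Rmult_1_l; apply RInt_ext; intros s _.
    rewrite pow_i, Rminus_0_l, Rmult_0_r, Rmult_0_l, cos_0 by auto with arith.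
    apply Rmult_1_r. }
apply (increment_bound F (fun u => exp (u ^ 2 - T ^ 2) * sin (2 * u * T))).
- intros u.
  replace (exp (u ^ 2 - T ^ 2) * sin (2 * u * T))
    with (exp (u ^ 2 - T ^ 2) * sin (2 * u * T)
          - exp (u ^ 2 - 0 ^ 2) * sin (2 * u * 0))
    by (rewrite Rmult_0_r, sin_0; ring).
  apply (is_derive_RInt_exact
    (fun u s => exp (u ^ 2 - s ^ 2) * cos (2 * u * s))
    (fun u s => exp (u ^ 2 - s ^ 2) * (2 * u * cos (2 * u * s) - 2 * s * sin (2 * u * s)))
    (fun u s => exp (u ^ 2 - s ^ 2) * sin (2 * u * s))).
  + intros; auto_derive; [trivial|]; unfold Rminus; simpl; ring.
  + intros; auto_derive; [trivial|]; unfold Rminus; simpl; ring.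
  + continuous_by_derive.
  + continuity_2d.
- intros u; apply Rabs_mult_le_1; [apply Rlt_le, exp_pos | apply SIN_bound].
Qed.

(** The imaginary part of the same shift. Here the side on the imaginary axis contributes - exp
    (u^2) to the derivative, so [D] is added to the integral to cancel it; the sum vanishes at
    height 0. *)
Lemma is_lim_gauss_sin (y : R) :
  is_lim (fun T => RInt (fun s => - (exp (y ^ 2 - s ^ 2) * sin (2 * y * s))) 0 T)
    p_infty (- RInt (fun u => exp (u ^ 2)) 0 y).
Proof.
set (D := fun u => RInt (fun v => exp (v ^ 2)) 0 u).
assert (HD : forall u, is_derive D u (exp (u ^ 2))).
{ intros u; apply (is_derive_RInt (V := R_NormedModule) (fun v => exp (v ^ 2)) D 0).
  - apply filter_forall; intros v; apply (RInt_correct (V := R_CompleteNormedModule)).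
    ex_RInt_by_derive.
  - continuous_by_derive. }
apply (is_lim_ext
  (fun T => RInt (fun s => - (exp (y ^ 2 - s ^ 2) * sin (2 * y * s))) 0 T + D y - D y));
  [intros; ring|].
fold (D y); rewrite <- (Rminus_0_l (D y)).
apply is_lim_minus'; [|apply is_lim_const].
replace (Finite 0) with (Finite (0 * (sqrt PI / 2))) by (f_equal; ring).
apply is_lim_gauss_approx with (Rabs y * exp (y ^ 2)); intros T.
set (F := fun u => RInt (fun s => - (exp (u ^ 2 - s ^ 2) * sin (2 * u * s))) 0 T + D u).
replace (0 * gauss T) with (F 0).
2:{ unfold F, D; rewrite RInt_point, (RInt_ext _ (fun _ => 0)).
    - rewrite RInt_const; unfold scal, zero; simpl; unfold mult; simpl; ring.
    - intros s _; rewrite Rmult_0_r, Rmult_0_l, sin_0, Rmult_0_r; apply Ropp_0. }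
apply (increment_bound F (fun u => exp (u ^ 2 - T ^ 2) * cos (2 * u * T))).
- intros u.
  replace (exp (u ^ 2 - T ^ 2) * cos (2 * u * T))
    with (exp (u ^ 2 - T ^ 2) * cos (2 * u * T)
          - exp (u ^ 2 - 0 ^ 2) * cos (2 * u * 0) + exp (u ^ 2))
    by (rewrite Rmult_0_r, cos_0, pow_i, Rminus_0_r by auto with arith; ring).
  apply (is_derive_plus
    (fun u => RInt (fun s => - (exp (u ^ 2 - s ^ 2) * sin (2 * u * s))) 0 T) D);
    [|apply HD].
  apply (is_derive_RInt_exact
    (fun u s => - (exp (u ^ 2 - s ^ 2) * sin (2 * u * s)))
    (fun u s => - (exp (u ^ 2 - s ^ 2) * (2 * u * sin (2 * u * s) + 2 * s * cos (2 * u * s))))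
    (fun u s => exp (u ^ 2 - s ^ 2) * cos (2 * u * s))).
  + intros; auto_derive; [trivial|]; unfold Rminus; simpl; ring.
  + intros; auto_derive; [trivial|]; unfold Rminus; simpl; ring.
  + continuous_by_derive.
  + continuity_2d.
- intros u; apply Rabs_mult_le_1; [apply Rlt_le, exp_pos | apply COS_bound].
Qed.

Lemma RInt_gen_C (f : R -> C) (a l m : R) :
  (forall b, ex_RInt (fun s => fst (f s)) a b) ->
  (forall b, ex_RInt (fun s => snd (f s)) a b) ->
  is_lim (fun b => RInt (fun s => fst (f s)) a b) p_infty l ->
  is_lim (fun b => RInt (fun s => snd (f s)) a b) p_infty m ->
  RInt_gen (V := C_R_CompleteNormedModule) f (at_point a) (Rbar_locally p_infty) = (l, m).
Proof.
intros I1 I2 L1 L2; apply is_RInt_gen_unique.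
set (F := fun ab : R * R =>
  (RInt (fun s => fst (f s)) a (snd ab), RInt (fun s => snd (f s)) a (snd ab)) : C).
apply (filterlimi_lim_ext_loc F).
(* The set [eq a] belongs to [at_point a], so the lower endpoint is frozen and only the upper one
   moves. *)
- exists (eq a) (fun _ => True); [reflexivity | apply filter_true |].
  intros x y <- _; unfold F; simpl.
  apply (is_RInt_fct_extend_pair (U := R_NormedModule) (V := R_NormedModule));
    apply (RInt_correct (V := R_CompleteNormedModule)); trivial.
- apply (filterlim_comp _ _ _ snd
    (fun b => (RInt (fun s => fst (f s)) a b, RInt (fun s => snd (f s)) a b) : C)
    _ (Rbar_locally p_infty)); [apply filterlim_snd|].
  apply (proj2 (filterlim_locally (U := C_UniformSpace) _ _)); intros e.
  apply filter_and.
  + apply (proj1 (filterlim_locally _ _) L1).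
  + apply (proj1 (filterlim_locally _ _) L2).
Qed.

Lemma erfc_imag (y : R) :
  erfc (Ci * y) = (1, - (2 / sqrt PI * RInt (fun u => exp (u ^ 2)) 0 y)).
Proof.
assert (Hf : forall s : R, Cexp (- (Ci * y + s) ^ 2) =
  (exp (y ^ 2 - s ^ 2) * cos (2 * y * s), - (exp (y ^ 2 - s ^ 2) * sin (2 * y * s)))).
{ intros s; unfold Cexp.
  replace (Re (- (Ci * y + s) ^ 2)) with (y ^ 2 - s ^ 2) by (simpl; ring).
  replace (Im (- (Ci * y + s) ^ 2)) with (- (2 * y * s)) by (simpl; ring).
  rewrite cos_neg, sin_neg; f_equal; ring. }
assert (HI : Cray_int (fun t => Cexp (- t ^ 2)) (Ci * y) =
  (sqrt PI / 2, - RInt (fun u => exp (u ^ 2)) 0 y)).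
{ unfold Cray_int; apply (RInt_gen_C (fun s : R => Cexp (- (Ci * y + s) ^ 2))).
  - intros b; apply ex_RInt_ext with (fun s => exp (y ^ 2 - s ^ 2) * cos (2 * y * s)).
    + intros s _; rewrite Hf; reflexivity.
    + ex_RInt_by_derive.
  - intros b; apply ex_RInt_ext with (fun s => - (exp (y ^ 2 - s ^ 2) * sin (2 * y * s))).
    + intros s _; rewrite Hf; reflexivity.
    + ex_RInt_by_derive.
  - eapply is_lim_ext; [|apply (is_lim_gauss_cos y)].
    intros b; apply RInt_ext; intros s _; rewrite Hf; reflexivity.
  - eapply is_lim_ext; [|apply (is_lim_gauss_sin y)].
    intros b; apply RInt_ext; intros s _; rewrite Hf; reflexivity. }
assert (sqrt PI <> 0) by apply Rgt_not_eq, sqrt_lt_R0, PI_RGT_0.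
unfold erfc; rewrite HI, <- RtoC_div by assumption.
apply injective_projections; simpl; field; assumption.
Qed.

(** * Values of erfi at conjugate points *)

Lemma RInt_even_opp (f : R -> R) (b : R) :
  (forall x, f (- x) = f x) -> ex_RInt f 0 b -> RInt f 0 (- b) = - RInt f 0 b.
Proof.
intros Hf If; apply is_RInt_unique.
(* The reflection x -> - x produces one outer [opp]; the inner one is the sign in the result. *)
apply is_RInt_ext with (fun x => opp (opp (f (- x)))).
- intros x _; rewrite opp_opp; apply Hf.
- apply (is_RInt_comp_opp (fun x => opp (f x))).
  rewrite Ropp_0, Ropp_involutive.
  apply (is_RInt_opp (V := R_NormedModule)), (RInt_correct (V := R_CompleteNormedModule)), If.
Qed.

Lemma RInt_lin_comb (f g : R -> R) (p q a b : R) :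
  ex_RInt f a b -> ex_RInt g a b ->
  RInt (fun t => p * f t + q * g t) a b = p * RInt f a b + q * RInt g a b.
Proof.
intros If Ig; apply is_RInt_unique.
apply (is_RInt_plus (V := R_NormedModule) (fun t => p * f t) (fun t => q * g t));
  apply (is_RInt_scal (V := R_NormedModule));
  apply (RInt_correct (V := R_CompleteNormedModule)); assumption.
Qed.

Lemma RInt_C (f : R -> C) (a b : R) :
  ex_RInt (fun t => fst (f t)) a b -> ex_RInt (fun t => snd (f t)) a b ->
  RInt (V := C_R_CompleteNormedModule) f a b =
  (RInt (fun t => fst (f t)) a b, RInt (fun t => snd (f t)) a b).
Proof.
intros I1 I2; apply is_RInt_unique.
apply (is_RInt_fct_extend_pair (U := R_NormedModule) (V := R_NormedModule));
  apply (RInt_correct (V := R_CompleteNormedModule)); assumption.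
Qed.

(** For z = a + i b the segment integral is z times the integral of exp (t^2 z^2), with z^2 = a^2 -
    b^2 + 2 i a b; the product is then split into components. *)
Lemma erfi_rect (a b : R) :
  erfi (a, b) =
  (2 / sqrt PI * RInt (fun t => exp (t ^ 2 * (a ^ 2 - b ^ 2)) *
     (a * cos (2 * a * b * t ^ 2) - b * sin (2 * a * b * t ^ 2))) 0 1,
   2 / sqrt PI * RInt (fun t => exp (t ^ 2 * (a ^ 2 - b ^ 2)) *
     (a * sin (2 * a * b * t ^ 2) + b * cos (2 * a * b * t ^ 2))) 0 1).
Proof.
set (c := fun t => exp (t ^ 2 * (a ^ 2 - b ^ 2)) * cos (2 * a * b * t ^ 2)).
set (s := fun t => exp (t ^ 2 * (a ^ 2 - b ^ 2)) * sin (2 * a * b * t ^ 2)).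
assert (Ic : ex_RInt c 0 1) by (unfold c; ex_RInt_by_derive).
assert (Is : ex_RInt s 0 1) by (unfold s; ex_RInt_by_derive).
assert (Hf : forall t : R, Cexp ((0 + t * ((a, b) - 0)) ^ 2) = (c t, s t)).
{ intros t; unfold Cexp.
  replace (Re ((0 + t * ((a, b) - 0)) ^ 2)) with (t ^ 2 * (a ^ 2 - b ^ 2)) by (simpl; ring).
  replace (Im ((0 + t * ((a, b) - 0)) ^ 2)) with (2 * a * b * t ^ 2) by (simpl; ring).
  reflexivity. }
assert (HI : Csegment_int (fun t => Cexp (t ^ 2)) 0 (a, b) =
  (((a, b) - 0) * (RInt c 0 1, RInt s 0 1))%C).
{ unfold Csegment_int; f_equal.
  rewrite (RInt_ext (V := C_R_CompleteNormedModule) _ (fun t => (c t, s t) : C))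
    by (intros; apply Hf).
  apply (RInt_C (fun t => (c t, s t))); assumption. }
transitivity (2 / sqrt PI * (a * RInt c 0 1 + - b * RInt s 0 1),
              2 / sqrt PI * (a * RInt s 0 1 + b * RInt c 0 1)).
- assert (sqrt PI <> 0) by apply Rgt_not_eq, sqrt_lt_R0, PI_RGT_0.
  unfold erfi; rewrite HI, <- RtoC_div by assumption.
  apply injective_projections; simpl; ring.
- rewrite <- !RInt_lin_comb by assumption.
  f_equal; f_equal; apply RInt_ext; intros; unfold c, s; simpl; ring.
Qed.

(* Both sides are the imaginary part of the integral of exp (z^2) from 0 to a + ib, along the
   segment and along 0 -> a -> a + ib. *)
Lemma RInt_segment_vertical (a b : R) :
  RInt (fun t => exp (t ^ 2 * (a ^ 2 - b ^ 2)) *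
    (a * sin (2 * a * b * t ^ 2) + b * cos (2 * a * b * t ^ 2))) 0 1 =
  RInt (fun u => exp (a ^ 2 - u ^ 2) * cos (2 * a * u)) 0 b.
Proof.
set (H := fun u => RInt (fun t => exp (t ^ 2 * (a ^ 2 - u ^ 2)) *
  (a * sin (2 * a * u * t ^ 2) + u * cos (2 * a * u * t ^ 2))) 0 1).
assert (H0 : H 0 = 0).
{ unfold H; rewrite (RInt_ext _ (fun _ => 0)).
  - rewrite RInt_const; unfold scal; simpl; unfold mult; simpl; ring.
  - intros t _; rewrite Rmult_0_r, !Rmult_0_l, sin_0, Rmult_0_r, Rplus_0_l.
    apply Rmult_0_r. }
fold (H b); symmetry.
replace (H b) with (minus (H b) (H 0)) by (rewrite H0; apply Rminus_0_r).
apply is_RInt_unique, (is_RInt_derive H); [|continuous_by_derive].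
intros u _.
(* With z = a + i u, the z-derivative of z exp (t^2 z^2) equals the t-derivative of t exp (t^2 z^2).
   As dz/du = i, the u-derivative of the imaginary part is the t-derivative of the real part of t
   exp (t^2 z^2), whose boundary values are subtracted here. *)
replace (exp (a ^ 2 - u ^ 2) * cos (2 * a * u)) with
  (1 * exp (1 ^ 2 * (a ^ 2 - u ^ 2)) * cos (2 * a * u * 1 ^ 2)
   - 0 * exp (0 ^ 2 * (a ^ 2 - u ^ 2)) * cos (2 * a * u * 0 ^ 2))
  by (rewrite pow1, !Rmult_1_l, Rmult_1_r; ring).
apply (is_derive_RInt_exact
  (fun u t => exp (t ^ 2 * (a ^ 2 - u ^ 2)) *
    (a * sin (2 * a * u * t ^ 2) + u * cos (2 * a * u * t ^ 2)))
  (fun u t => exp (t ^ 2 * (a ^ 2 - u ^ 2)) *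
    ((1 + 2 * t ^ 2 * (a ^ 2 - u ^ 2)) * cos (2 * a * u * t ^ 2)
     - 4 * a * u * t ^ 2 * sin (2 * a * u * t ^ 2)))
  (fun u t => t * exp (t ^ 2 * (a ^ 2 - u ^ 2)) * cos (2 * a * u * t ^ 2))).
- intros; auto_derive; [trivial|]; unfold Rminus; simpl; ring.
- intros; auto_derive; [trivial|]; unfold Rminus; simpl; ring.
- continuous_by_derive.
- continuity_2d.
Qed.

(** Conjugating the argument conjugates erfi, so the real parts cancel and the imaginary part
    doubles. *)
Lemma erfi_conj_sub (a b : R) :
  (erfi (a, (- b)%R) - erfi (a, b))%C =
  (0, - 2 * (2 / sqrt PI * RInt (fun u => exp (a ^ 2 - u ^ 2) * cos (2 * a * u)) 0 b)).
Proof.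
rewrite !erfi_rect, !RInt_segment_vertical.
rewrite (RInt_even_opp (fun u => exp (a ^ 2 - u ^ 2) * cos (2 * a * u))).
2:{ intros u; replace ((- u) ^ 2) with (u ^ 2) by ring.
    replace (2 * a * - u) with (- (2 * a * u)) by ring; rewrite cos_neg; reflexivity. }
2: ex_RInt_by_derive.
rewrite (RInt_ext _ (fun t => exp (t ^ 2 * (a ^ 2 - b ^ 2)) *
  (a * cos (2 * a * b * t ^ 2) - b * sin (2 * a * b * t ^ 2)))).
2:{ intros t _.
    replace (2 * a * - b * t ^ 2) with (- (2 * a * b * t ^ 2)) by ring.
    rewrite cos_neg, sin_neg.
    replace ((- b) ^ 2) with (b ^ 2) by ring.
    simpl; ring. }
apply injective_projections; simpl; ring.
Qed.

(** * The substitution x = sin t *)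

(** The substitution needs continuity up to x = 1, where [asin] has no finite derivative; there it
    follows from monotonicity of sin. *)
Lemma continuous_asin (x : R) : 0 <= x <= 1 -> continuous asin x.
Proof.
intros Hx; apply continuity_pt_filterlim.
destruct (Rlt_le_dec x 1) as [H|H].
{ apply derivable_continuous_pt, derivable_pt_asin; lra. }
replace x with 1 by lra.
intros e He; rewrite asin_1.
assert (HPI := PI_RGT_0).
(* The cap PI/2 keeps PI/2 - d in [0, PI/2], where sin is increasing. *)
set (d := Rmin e (PI / 2)).
assert (Hd : 0 < d <= e /\ d <= PI / 2).
{ unfold d; repeat split; [apply Rmin_pos; lra | apply Rmin_l | apply Rmin_r]. }
assert (Hs : sin (PI / 2 - d) < 1).
{ rewrite <- sin_PI2; apply sin_increasing_1; lra. }
assert (Hs0 : 0 <= sin (PI / 2 - d)) by (apply sin_ge_0; lra).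
exists (1 - sin (PI / 2 - d)); split; [lra|].
intros z [_ Hz]; simpl in *; unfold Rdist in *.
apply Rabs_lt_between in Hz.
assert (Hb := asin_bound z).
apply Rabs_def1; [lra|].
destruct (Rle_lt_dec 1 z) as [H1|H1].
(* To the right of 1 the total function [asin] has the constant value PI/2. *)
- unfold asin; destruct (Rle_dec z (-1)); [lra|].
  destruct (Rle_dec 1 z); lra.
- assert (PI / 2 - d < asin z); [|lra].
  apply sin_increasing_0; try lra.
  rewrite sin_asin; lra.
Qed.

Lemma RInt_exp_asin :
  RInt (fun x => exp (- (asin x) ^ 2)) 0 1 =
  RInt (fun t => exp (- t ^ 2) * cos t) 0 (PI / 2).
Proof.
assert (HPI := PI_RGT_0).
rewrite <- sin_0 at 1; rewrite <- sin_PI2.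
rewrite <- (RInt_comp _ sin cos).
- apply RInt_ext; intros t Ht.
  rewrite Rmin_left, Rmax_right in Ht by lra.
  rewrite asin_sin by lra.
  apply Rmult_comm.
- intros t Ht; rewrite Rmin_left, Rmax_right in Ht by lra.
  apply (continuous_comp asin (fun u => exp (- u ^ 2))).
  + apply continuous_asin; split; [apply sin_ge_0; lra | apply SIN_bound].
  + continuous_by_derive.
- intros t _; split; [auto_derive; [trivial | ring] | continuous_by_derive].
Qed.

Theorem theorem3p9 :
  RtoC (RInt (fun x : R => exp (- (asin x) ^ 2)) 0 1) =
  (RtoC (sqrt PI * exp (- (1 / 4)) / 4) *
   (erfc (Ci / 2) + erfc (- (Ci / 2)) +
    Ci * (erfi (1 / 2 - Ci * PI / 2) - erfi (1 / 2 + Ci * PI / 2) + 2 * Ci)))%C.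
Proof.
assert (sqrt PI <> 0) by apply Rgt_not_eq, sqrt_lt_R0, PI_RGT_0.
replace (Ci / 2)%C with (Ci * RtoC (1 / 2))%C
  by (apply injective_projections; simpl; field).
replace (- (Ci * RtoC (1 / 2)))%C with (Ci * RtoC (- (1 / 2)))%C
  by (apply injective_projections; simpl; field).
replace (1 / 2 - Ci * PI / 2)%C with (1 / 2, - (PI / 2))
  by (apply injective_projections; simpl; field).
replace (1 / 2 + Ci * PI / 2)%C with (1 / 2, PI / 2)
  by (apply injective_projections; simpl; field).
rewrite erfi_conj_sub, !erfc_imag, RInt_exp_asin.
rewrite (RInt_even_opp (fun u => exp (u ^ 2))).
2:{ intros u; f_equal; ring. }
2: ex_RInt_by_derive.
(* At a = 1/2 the frequency 2 a is 1, and the factor exp (1/4) will cancel the prefactor exp (-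
   1/4). *)
assert (Hscal : RInt (fun u => exp ((1 / 2) ^ 2 - u ^ 2) * cos (2 * (1 / 2) * u)) 0 (PI / 2) =
  exp (1 / 4) * RInt (fun u => exp (- u ^ 2) * cos u) 0 (PI / 2)).
{ apply is_RInt_unique.
  apply is_RInt_ext with (fun u => exp (1 / 4) * (exp (- u ^ 2) * cos u)).
  - intros u _; replace ((1 / 2) ^ 2 - u ^ 2) with (1 / 4 + - u ^ 2) by field.
    replace (2 * (1 / 2) * u) with u by field.
    rewrite exp_plus; symmetry; apply Rmult_assoc.
  - apply (is_RInt_scal (V := R_NormedModule)).
    apply (RInt_correct (V := R_CompleteNormedModule)); ex_RInt_by_derive. }
rewrite Hscal.
rewrite exp_Ropp.
assert (exp (1 / 4) <> 0) by apply Rgt_not_eq, exp_pos.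
set (I := RInt (fun t => exp (- t ^ 2) * cos t) 0 (PI / 2)).
set (J := RInt (fun u => exp (u ^ 2)) 0 (1 / 2)).
(* Both integrals become opaque reals for [field]: [J] cancels between the two erfc values, and [I]
   survives with coefficient 1. *)
clearbody I J; change R in I, J.
apply injective_projections; simpl; field; split; assumption.
Qed.
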